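(* For all natural numbers $n, k$ with $n \geq k \geq 0$, the integer $$\left[\begin{array}{c} n \\ k \end{array}\right] := \frac{\mathrm{lcm}(n, n-1, \dots, n-k+1)}{\mathrm{lcm}(1, 2, \dots, k)}$$ divides the binomial coefficient $\binom{n}{k}$.
   Context: The least common multiple of the empty set is taken to be $1$ (so the expression equals $1$ when $k=0$). $\mathbb{N}$ denotes the set of nonnegative integers. *)

(* Defs.v *)
From mathcomp Require Import all_boot.

Set Implicit Arguments.
Unset Strict Implicit.
Unset Printing Implicit Defensive.

(* lcm(n, n-1, ..., n-k+1); the subtraction is never truncated when k <= n. *)
Definition lcm_falling (n k : nat) : nat := \big[lcmn/1]_(i < k) (n - i).

Definition lcm_upto (k : nat) : nat := \big[lcmn/1]_(1 <= i < k.+1) i.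

(* A Euclidean quotient: it is the fraction of the two lcms only when the
   division is exact. *)
Definition lcm_binomial (n k : nat) : nat := lcm_falling n k %/ lcm_upto k.

(* Main.v *)
Require Import Defs.
From mathcomp Require Import all_boot.

(** If [i < k], Vandermonde gives
    ['C(n, k) = \sum_j 'C(i, j) * 'C(n - i, k - j)], where only [j <= i]
    contributes, so that [0 < k - j <= k]. By absorption [n - i] divides
    [(k - j) * 'C(n - i, k - j)], hence every term multiplied by
    [lcm(1, ..., k)], hence [lcm(1, ..., k) * 'C(n, k)]. *)

Lemma lcm_uptoE (k : nat) : lcm_upto k = \big[lcmn/1]_(i < k) i.+1.
Proof. by rewrite /lcm_upto big_add1 big_mkord. Qed.

Lemma dvdn_lcm_upto (i k : nat) : 0 < i <= k -> i %| lcm_upto k.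
Proof.
case: i => // i lt_ik; rewrite lcm_uptoE.
exact: (biglcmn_sup (Ordinal lt_ik)).
Qed.

Lemma lcm_upto_gt0 (k : nat) : 0 < lcm_upto k.
Proof.
rewrite lcm_uptoE; elim/big_ind: _ => // x y x_gt0 y_gt0.
by rewrite lcmn_gt0 x_gt0.
Qed.

Lemma dvdn_mul_bin (m r : nat) : 0 < r -> m %| r * 'C(m, r).
Proof. by case: r => // r _; rewrite -mul_bin_diag dvdn_mulr. Qed.

Lemma dvdn_lcm_upto_bin (n k i : nat) :
  i < k -> k <= n -> n - i %| lcm_upto k * 'C(n, k).
Proof.
move=> lt_ik le_kn; have le_in : i <= n by rewrite ltnW ?(leq_trans lt_ik).
(* Only the [n] of the binomial is split as [i + (n - i)]; the divisor [n - i] stays intact. *)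
rewrite -{2}(subnKC le_in) -Vandermonde big_distrr /=.
apply: dvdn_sum => j _; have [lt_ij | le_ji] := ltnP i j.
  by rewrite bin_small // muln0.
have kj_gt0 : 0 < k - j by rewrite subn_gt0 (leq_ltn_trans le_ji).
rewrite mulnCA dvdn_mull //; apply: dvdn_trans (dvdn_mul_bin _ _ kj_gt0) _.
by rewrite dvdn_mul // dvdn_lcm_upto // kj_gt0 leq_subr.
Qed.

(** Rounding [n] down to a multiple of [i.+1] subtracts [n %% i.+1 < k], so the result is one of the
    factors [n - r] with [r < k]. *)
Lemma lcm_upto_dvd_falling (n k : nat) : lcm_upto k %| lcm_falling n k.
Proof.
rewrite lcm_uptoE; apply/dvdn_biglcmP => i _.
have lt_rk : n %% i.+1 < k by rewrite (leq_trans _ (ltn_ord i)) ?ltn_mod.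
apply: (biglcmn_sup (Ordinal lt_rk)) => //=.
by rewrite {1}(divn_eq n i.+1) addnK dvdn_mull.
Qed.

Lemma lcm_falling_dvd_bin (n k : nat) :
  k <= n -> lcm_falling n k %| lcm_upto k * 'C(n, k).
Proof.
by move=> le_kn; apply/dvdn_biglcmP => i _; apply: dvdn_lcm_upto_bin.
Qed.

Theorem theorem1 (n k : nat) (hkn : k <= n) :
  (lcm_upto k %| lcm_falling n k) /\ (lcm_binomial n k %| 'C(n, k)).
Proof.
have dvd_falling := lcm_upto_dvd_falling n k; split=> //.
(* Multiplying both sides by [lcm_upto k] cancels the quotient, since [dvd_falling] makes the
   division exact. *)
rewrite -(dvdn_pmul2l (lcm_upto_gt0 k)) /lcm_binomial mulnC divnK //.
exact: lcm_falling_dvd_bin.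
Qed.
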